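(* Let $\kappa$ be an infinite strong limit cardinal and let $\delta$ be the least cardinal such that $2^\delta\geq\operatorname{cf}(\kappa)$. Then $\mathfrak{sd}(\delta,\kappa)=2^\kappa$. In particular, $\mathfrak{sd}(\aleph_0,\aleph_0)=2^{\aleph_0}$.
   Context: Work in ZFC. A cardinal $\kappa$ is a strong limit if $2^\lambda<\kappa$ for all cardinals $\lambda<\kappa$ (so $\aleph_0$ is a strong limit). For a set $X$, $2^X$ is the set of functions $X\to 2$. For $F\subseteq 2^X$ and $A\subseteq X$, $F\upharpoonright A=\{f\upharpoonright A : f\in F\}$, and $F$ shatters $A$ if $F\upharpoonright A=2^A$. The string dimension $\mathrm{d}_{\mathfrak{s}}(F)$ is the least cardinal $\delta$ such that $F$ shatters no $A\subseteq X$ with $|A|=\delta$. For cardinals $\delta,\kappa$ let $\mathcal{S}(\delta,\kappa)=\{F\subseteq 2^\kappa : \mathrm{d}_{\mathfrak{s}}(F)<\delta\}$, and let $\mathcal{I}_{\mathfrak{s}}(\delta,\kappa)$ be the $\sigma$-ideal on $2^\kappa$ generated by it, i.e. the collection of all $B\subseteq 2^\kappa$ contained in a union of at most countably many members of $\mathcal{S}(\delta,\kappa)$. For infinite cardinals $\delta,\kappa$ with $\delta\leq\kappa^+$, $\mathfrak{sd}(\delta,\kappa)$ is the covering number of $\mathcal{I}_{\mathfrak{s}}(\delta,\kappa)$: the least cardinality of a family $\mathcal{A}\subseteq\mathcal{I}_{\mathfrak{s}}(\delta,\kappa)$ with $\bigcup\mathcal{A}=2^\kappa$. *)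

(* Defs.v *)
From mathcomp Require Import all_boot.
From mathcomp Require Import boolp classical_sets functions cardinality.
From mathcomp Require Import wochoice.

Set Implicit Arguments.
Unset Strict Implicit.
Unset Printing Implicit Defensive.

Local Open Scope classical_set_scope.
Local Open Scope card_scope.

(* A cardinal is represented by an arbitrary type of that cardinality, and the
   cardinal 2^lambda by [L -> bool] for a type [L] representing lambda.
   Operations on cardinals are relations: [is_op X] says that the type [X] has
   the cardinality denoted by [op]. *)

Definition card_lt T U (A : set T) (B : set U) : Prop :=
  (A #<= B) /\ ~ (B #<= A).

Definition is_least_card (P : Type -> Prop) (X : Type) : Prop :=
  P X /\ forall Y : Type, P Y -> [set: X] #<= [set: Y].

Definition strong_limit (K : Type) : Prop :=
  forall L : Type, card_lt [set: L] [set: K] ->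
    card_lt [set: L -> bool] [set: K].

(* [R] (the non-strict order) well-orders [K] in order type the initial ordinal
   of cardinality |K|. *)
Definition initial_well_order (K : Type) (R : rel K) : Prop :=
  well_order R /\
  forall x, card_lt [set y | R y x /\ y <> x] [set: K].

Definition cofinal (K : Type) (R : rel K) (A : set K) : Prop :=
  forall x, exists2 y, A y & R x y.

(* All initial well-orders of [K] are isomorphic, so the choice of [R] is
   immaterial. *)
Definition is_cofinality (K C : Type) : Prop :=
  exists R : rel K, initial_well_order R /\
    is_least_card
      (fun X => exists A : set K, cofinal R A /\ A #= [set: X]) C.

Definition restrict_family (X : Type) (F : set (X -> bool)) (A : set X) :
    set (A -> bool) :=
  [set sigL A f | f in F].
Arguments restrict_family {X} F A.

Definition shatters (X : Type) (F : set (X -> bool)) (A : set X) : Prop :=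
  restrict_family F A = [set: A -> bool].

Definition is_string_dim (X : Type) (F : set (X -> bool)) (S : Type) : Prop :=
  is_least_card
    (fun Y => forall A : set X, A #= [set: Y] -> ~ shatters F A) S.

Definition string_small (D K : Type) : set (set (K -> bool)) :=
  [set F | exists S : Type, is_string_dim F S /\ card_lt [set: S] [set: D]].
Arguments string_small D K : clear implicits.

Definition string_ideal (D K : Type) : set (set (K -> bool)) :=
  [set B | exists G : set (set (K -> bool)),
     [/\ countable G, G `<=` string_small D K & B `<=` \bigcup_(F in G) F]].
Arguments string_ideal D K : clear implicits.

Definition is_sd (D K X : Type) : Prop :=
  is_least_card
    (fun Y => exists A : set (set (K -> bool)),
       [/\ A `<=` string_ideal D K, \bigcup_(B in A) B = [set: K -> bool]
         & A #= [set: Y]]) X.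

(* Main.v *)
(* Index coordinates of 2^K by pairs (m, g) with m in K and g a function
   2^{y <= m} -> 2; as K is a strong limit there are at most |K| of them, so some
   Phi : 2^K -> 2^K satisfies Phi(x)(m, g) = g(x restricted to {y <= m}).  If
   2^S < cf(K), then any 2^S distinct points x_b (b in 2^S) have distinct
   restrictions to a common {y <= m}, and then the coordinates (m, g_s) (s in S),
   where g_s sends the restriction of x_b to b(s), are shattered by the Phi(x_b).
   Hence the Phi-preimage of a family of string dimension S < D has at most
   2^S <= |K| elements, and by Koenig's argument fewer than 2^K countable unions
   of such preimages cannot cover 2^K. *)
Require Import Defs.
From mathcomp Require Import all_boot.
From mathcomp Require Import boolp classical_sets functions cardinality.
From mathcomp Require Import wochoice.

Set Implicit Arguments.
Unset Strict Implicit.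
Unset Printing Implicit Defensive.

Local Open Scope classical_set_scope.
Local Open Scope card_scope.

(** * Cardinal comparison through injections and surjections *)

Lemma card_le_injP (T U : Type) :
  [set: T] #<= [set: U] <-> exists f : T -> U, injective f.
Proof.
split=> [/card_leP[f]|[f finj]].
  exists (fun x => val (f (SigSub (mem_set (I : [set: T] x))))) => x y /val_inj.
  by move=> /(@inj _ _ _ f); rewrite !in_setT => /(_ isT isT) [].
apply: (@card_le_trans _ _ _ (range f)); last exact: card_leT.
have : f @` setT #= [set: T] by apply: inj_card_eq => x y _ _; apply: finj.
by rewrite card_eq_le => /andP[].
Qed.

Lemma card_le_setT_injP (T U : Type) (A : set T) :
  A #<= [set: U] <-> exists f : A -> U, injective f.
Proof. by rewrite -card_le_injP (card_le_eql (card_setT A)). Qed.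

Lemma card_le_set_injP (T U : Type) (B : set U) :
  [set: T] #<= B <-> exists2 f : T -> U, injective f & forall x, B (f x).
Proof.
rewrite -(card_le_eqr (card_setT B)) card_le_injP; split=> [[f finj]|[f finj fB]].
  by exists (fun x => val (f x)) => [x y /val_inj/finj //|x]; apply: set_valP.
exists (fun x => SigSub (mem_set (fB x)) : B) => x y.
by move=> /(congr1 val) /finj.
Qed.

Lemma surj_card_le (T U : Type) (f : T -> U) :
  (forall u, exists t, f t = u) -> [set: U] #<= [set: T].
Proof.
move=> /choice[g fg]; apply/card_le_injP; exists g.
exact: can_inj fg.
Qed.

Lemma card_le_pow (T U : Type) :
  [set: T] #<= [set: U] -> [set: T -> bool] #<= [set: U -> bool].
Proof.
move=> /card_le_injP[f finj].
apply/card_le_injP; exists (fun b u => `[< exists2 t, f t = u & b t >]) => b b' bb'.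
apply/funext => t; have e := asbool_eq_equiv (congr1 (@^~ (f t)) bb').
apply/idP/idP => bt.
  by have [|s /finj -> //] := (e.1 _); exists t.
by have [|s /finj -> //] := (e.2 _); exists t.
Qed.

Lemma card_le_pow_self (T : Type) : [set: T] #<= [set: T -> bool].
Proof.
apply/card_le_injP; exists (fun t s => `[< t = s >]) => t s ts.
by apply: (asbool_eq_equiv (congr1 (@^~ s) ts)).2.
Qed.

(* Kuratowski pairs. *)
Lemma card_le_square_pow (T : Type) :
  [set: T * T] #<= [set: (T -> bool) -> bool].
Proof.
apply/card_le_injP.
pose u (x y : T) : T -> bool := fun z => `[< z = x \/ z = y >].
have uP x y z : u x y z <-> z = x \/ z = y by split => /asboolP.
have uinj x y x' y' : u x y = u x' y' -> (x = x' /\ y = y') \/ (x = y' /\ y = x').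
  move=> e.
  have h z : z = x \/ z = y <-> z = x' \/ z = y' by rewrite -!uP e.
  have [[/(_ (or_introl erefl)) hx _] [/(_ (or_intror erefl)) hy _]] := (h x, h y).
  have [[_ /(_ (or_introl erefl)) hx'] [_ /(_ (or_intror erefl)) hy']] := (h x', h y').
  by intuition congruence.
exists (fun p s => `[< s = u p.1 p.1 \/ s = u p.1 p.2 >]) => -[x y] [x' y'] /= e.
have h z : z = u x x \/ z = u x y <-> z = u x' x' \/ z = u x' y'.
  exact: asbool_eq_equiv (congr1 (@^~ z) e).
have /(_ (or_introl erefl)) h1 := (h (u x x)).1.
have /(_ (or_intror erefl)) h2 := (h (u x y)).1.
have /(_ (or_intror erefl)) h3 := (h (u x' y')).2.
by case: h1 => /uinj ?; case: h2 => /uinj ?; case: h3 => /uinj ?; intuition congruence.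
Qed.

(** * Well-orders and their elementary properties *)

Section WellOrder.
Context {T : Type} {R : rel T} (woR : well_order R).

(** Carries the well-order property from boolean predicates to arbitrary propositions. The
    uniqueness clause on lower bounds is what later yields antisymmetry, applied to a two-point
    predicate. *)
Lemma well_order_min (P : T -> Prop) x : P x ->
  exists z, [/\ P z, forall y, P y -> R z y &
    forall w, P w -> (forall y, P y -> R w y) -> w = z].
Proof.
move=> Px; have [|z [[/asboolP Pz zlb] zu]] := @woR (fun z => `[< P z >]).
  by exists x; apply/asboolP.
exists z; split=> // [y Py|w Pw wlb]; first exact/zlb/asboolP.
by rewrite (zu w) //; split; [exact/asboolP|move=> y /asboolP/wlb].
Qed.

Lemma well_order_total x y : R x y \/ R y x.
Proof.
have [|z [zA zlb _]] := @well_order_min (fun z => z = x \/ z = y) x; first by left.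
have [Rx Ry] : R z x /\ R z y by split; apply: zlb; [left|right].
by case: zA => <-; [left|right].
Qed.

Lemma well_order_refl x : R x x.
Proof. by have [] := well_order_total x x. Qed.

Lemma well_order_antisym x y : R x y -> R y x -> x = y.
Proof.
move=> xy yx.
have [|z [_ _ zu]] := @well_order_min (fun z => z = x \/ z = y) x; first by left.
have xz : x = z.
  by apply: zu; [left|move=> _ [] ->]; rewrite //; apply: well_order_refl.
have yz : y = z.
  by apply: zu; [right|move=> _ [] ->]; rewrite //; apply: well_order_refl.
by rewrite xz yz.
Qed.

Lemma well_order_trans x y z : R x y -> R y z -> R x z.
Proof.
move=> xy yz; have [|m [mA mlb _]] :=
  @well_order_min (fun t => [\/ t = x, t = y | t = z]) x; first by constructor 1.
have [mx my mz] : [/\ R m x, R m y & R m z].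
  by split; apply: mlb; [constructor 1|constructor 2|constructor 3].
case: mA => [<- //|e|e]; subst m.
  by rewrite (well_order_antisym xy mx).
by rewrite -(well_order_antisym yz my).
Qed.

Lemma well_order_wf : well_founded (fun x y => R x y /\ x <> y).
Proof.
move=> x; apply: contrapT => nx.
have [m [nm mlb _]] :=
  @well_order_min (fun z => ~ Acc (fun x y => R x y /\ x <> y) z) x nx.
apply: nm; constructor => y [ym ny]; apply: contrapT => nAy.
by apply: ny; apply: well_order_antisym => //; apply: mlb.
Qed.

End WellOrder.

(** * Transfinite recursion and comparability of cardinals *)

(** Nested induction: the outer one on [f x], the inner one on [x] within a fibre of [f]. *)
Lemma wf_lex_preimage (T U : Type) (ltT : T -> T -> Prop) (ltU : U -> U -> Prop)
    (f : T -> U) : well_founded ltU -> well_founded ltT ->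
  well_founded (fun x y => ltU (f x) (f y) \/ f x = f y /\ ltT x y).
Proof.
move=> wfU wfT x; move: {2}(f x) (erefl (f x)) => u; elim/(well_founded_ind wfU): u x.
move=> u IHu x; elim/(well_founded_ind wfT): x => x IHx fx.
constructor => y [|[fy yx]]; first by rewrite fx => /IHu; apply.
by apply: IHx => //; rewrite fy.
Qed.

(* Transfinite recursion: send each point outside the image of its segment. *)
Lemma wf_card_le (T U : Type) (lt : T -> T -> Prop) :
  well_founded lt -> (forall x y, x <> y -> lt x y \/ lt y x) ->
  (forall x, ~ ([set: U] #<= [set y | lt y x])) -> [set: T] #<= [set: U].
Proof.
move=> wf lt_total small.
have step x (rec : forall y, lt y x -> U) : {u | forall y h, rec y h <> u}.
  apply: cid; apply: contrapT => /forallNP full; apply: (small x).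
  rewrite -(card_le_eqr (card_setT [set y | lt y x])).
  apply: (@surj_card_le _ _ (fun y : [set y | lt y x] => rec (val y) (set_valP y))).
  move=> u; apply: contrapT => nu; apply: (full u) => y h e.
  apply: nu; exists (SigSub (mem_set (h : [set y | lt y x] y))).
  by rewrite -e; congr rec; apply: Prop_irrelevance.
pose f := Fix wf (fun=> U) (fun x rec => sval (step x rec)).
have fE x : f x = sval (step x (fun y _ => f y)).
  rewrite {1}/f Fix_eq //; move=> z g g' gg'; congr (sval (step z _)).
  by apply: functional_extensionality_dep => y; apply: functional_extensionality_dep.
have fneq y x : lt y x -> f y <> f x.
  by move=> yx; rewrite (fE x); exact: (svalP (step x (fun y _ => f y)) y yx).
apply/card_le_injP; exists f => x y fxy; apply: contrapT => /lt_total[] /fneq; auto.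
Qed.

(** Well-order [T]: either [U] embeds in a proper initial segment, or no segment can exhaust [U] and
    the recursion of [wf_card_le] embeds [T] in [U]. *)
Lemma card_le_total (T U : Type) : [set: T] #<= [set: U] \/ [set: U] #<= [set: T].
Proof.
have [R woR] := well_ordering_principle {classic T}.
have [[x Ux]|/forallNP small] :=
  pselect (exists x : T, [set: U] #<= [set y | R y x /\ y <> x]).
  by right; apply: card_le_trans Ux (card_leT _).
left; apply: (wf_card_le (well_order_wf woR)) => // x y xy.
by have [] := well_order_total woR x y; [left|right]; split=> // /esym.
Qed.

Lemma card_le_lt (T U V : Type) (A : set T) (B : set U) (C : set V) :
  A #<= B -> card_lt B C -> card_lt A C.
Proof.
move=> AB [BC nCB]; split; first exact: card_le_trans BC.
by move=> CA; apply: nCB; apply: card_le_trans AB.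
Qed.

(** * Segments, pairing and coding below a strong limit *)

Section StrongLimit.
Context {K : Type} {R : rel K}.
Hypothesis slK : strong_limit K.
Hypothesis woK : initial_well_order R.

Let woR : well_order R := woK.1.

(* y |-> {y} \ {m} embeds {y <= m} into the powerset of {y < m}. *)
Lemma segment_small m : card_lt [set: [set y | R y m]] [set: K].
Proof.
pose L : Type := [set y | R y m /\ y <> m].
have Lsmall : card_lt [set: L] [set: K].
  apply: card_le_lt (woK.2 m).
  by rewrite (card_le_eql (card_setT _)).
apply: card_le_lt (slK Lsmall).
apply/card_le_injP; exists (fun (y : [set y | R y m]) (z : L) => `[< val y = val z >]).
move=> y y' e; apply: val_inj.
have ne (z z' : [set y | R y m]) :
    (forall t : L, val z = val t <-> val z' = val t) -> val z <> m -> val z = val z'.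
  move=> h zm; pose t : L := SigSub
    (mem_set (conj (set_valP z) zm : [set y | R y m /\ y <> m] (val z))).
  by rewrite (h t).1.
have h (t : L) : val y = val t <-> val y' = val t.
  exact: asbool_eq_equiv (congr1 (@^~ t) e).
have [ym|] := pselect (val y = m); last exact: ne.
have [y'm|/ne <- //] := pselect (val y' = m); first by rewrite ym.
by move=> t; rewrite h.
Qed.

Lemma segment_pow_pow_small m :
  card_lt [set: ([set y | R y m] -> bool) -> bool] [set: K].
Proof. exact/slK/slK/segment_small. Qed.

(* Order the pairs by their maximum, breaking ties by an arbitrary well-order. *)
Lemma card_square_le : [set: K * K] #<= [set: K].
Proof.
have [W woW] := well_ordering_principle {classic K * K}.
pose mx (p : K * K) := if R p.1 p.2 then p.2 else p.1.
have mx1 p : R p.1 (mx p).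
  by rewrite /mx; case: ifPn => // _; apply: well_order_refl.
have mx2 p : R p.2 (mx p).
  rewrite /mx; case: ifPn => [_|]; first exact: well_order_refl.
  by have [->|] := well_order_total woR p.1 p.2.
apply: (wf_card_le
  (wf_lex_preimage mx (well_order_wf woR) (well_order_wf woW))).
  move=> p q pq; have [e|ne] := pselect (mx p = mx q).
    by have [] := well_order_total woW p q => ?; [left|right]; right;
      split=> //; split=> // /esym.
  by have [] := well_order_total woR (mx p) (mx q) => ?; [left|right]; left;
    split=> // /esym.
(* Pairs preceding [p] have both components in the segment [I] up to [mx p]. If [K] embedded in
   them, then [|K| <= |I * I| <= 2^(2^|I|)], against [segment_pow_pow_small]. *)
move=> p /card_le_set_injP[f finj flt]; have [_] := segment_pow_pow_small (mx p); apply.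
apply: card_le_trans (card_le_square_pow _).
have fR k : R (mx (f k)) (mx p).
  by have [[]//|[-> _]] := flt k; apply: well_order_refl.
have f1 k : R (f k).1 (mx p) by apply: well_order_trans (fR k).
have f2 k : R (f k).2 (mx p) by apply: well_order_trans (fR k).
apply/card_le_injP.
pose I := [set y | R y (mx p)].
exists (fun k => (SigSub (mem_set (f1 k : I _)) : I, SigSub (mem_set (f2 k : I _)) : I)).
move=> k k' [e1 e2]; apply: finj.
by rewrite (surjective_pairing (f k)) e1 e2 -surjective_pairing.
Qed.

(** Otherwise the range of [h] would be cofinal and no larger than [X], so [C] would embed in
    [X]. *)
Lemma bounded_of_card_lt (C X : Type) (h : X -> K) :
  (forall A : set K, cofinal R A -> [set: C] #<= A) ->
  ~ ([set: C] #<= [set: X]) -> exists m, forall i, R (h i) m.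
Proof.
move=> Cmin nCX; apply: contrapT => /forallNP unb; apply: nCX.
apply: card_le_trans (card_image_le h setT); apply: Cmin => m.
have /existsNP[i ni] := unb m; exists (h i); first by exists i.
by have [] := well_order_total woR m (h i).
Qed.

(* Bounding the differences in two stages, first over j and then over i, avoids
   the arithmetic fact |X * X| = |X|. *)
Lemma restriction_injective (C X : Type) (x : X -> K -> bool) :
  (forall A : set K, cofinal R A -> [set: C] #<= A) ->
  ~ ([set: C] #<= [set: X]) -> infinite_set [set: K] -> injective x ->
  exists m, injective (fun i => sigL [set y | R y m] (x i)).
Proof.
move=> Cmin nCX infK xinj.
have [k0 _] := infinite_setN0 infK.
(* [d (i, j)] is a coordinate at which [x i] and [x j] differ, with default [k0] when [i = j]. *)
have /choice[d dP] (p : X * X) : exists k, x p.1 k = x p.2 k -> p.1 = p.2.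
  have [->|ne] := pselect (p.1 = p.2); first by exists k0.
  apply: contrapT => /forallNP same; apply: ne; apply: xinj; apply/funext => k.
  by apply: contrapT => e; apply: (same k) => /e.
have /choice[b bP] i : exists m, forall j, R (d (i, j)) m.
  exact: bounded_of_card_lt Cmin nCX.
have [m mP] := bounded_of_card_lt b Cmin nCX.
exists m => i j e; apply: (dP (i, j)) => /=.
have dm : [set y | R y m] (d (i, j)) by apply: well_order_trans (bP i j) (mP i).
exact: (congr1 (@^~ (SigSub (mem_set dm) : [set y | R y m])) e).
Qed.

Lemma independent_coding : exists (Phi : (K -> bool) -> K -> bool)
    (code : forall m, (([set y | R y m] -> bool) -> bool) -> K),
  (forall m, injective (code m)) /\
  forall m g x, Phi x (code m g) = g (sigL [set y | R y m] x).
Proof.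
have /card_le_injP[c cinj] := card_square_le.
have inj m : {f : (([set y | R y m] -> bool) -> bool) -> K | injective f}.
  exact/cid/card_le_injP/(segment_pow_pow_small m).1.
pose e m := sval (inj m).
have einj m : injective (e m) := svalP (inj m).
(* Since [c] and each [e m] are injective, a coded coordinate determines [m] and [g], so its value
   is unambiguous; all other coordinates get the value false. *)
exists (fun x k => `[< exists m g, c (m, e m g) = k /\ g (sigL [set y | R y m] x) >]).
exists (fun m g => c (m, e m g)); split=> [m g g' /cinj [/einj]//|m g x].
apply/asboolP/idP => [[m' [g' [/cinj [em]]]]|gx]; last by exists m, g.
by move: em g' => -> g' /einj ->.
Qed.

End StrongLimit.

(** * Preimages of small families and the covering argument *)

Lemma preimage_string_small (K C D : Type) (R : rel K)
    (Phi : (K -> bool) -> K -> bool)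
    (code : forall m, (([set y | R y m] -> bool) -> bool) -> K) F :
  infinite_set [set: K] -> strong_limit K -> initial_well_order R ->
  (forall A : set K, cofinal R A -> [set: C] #<= A) -> [set: C] #<= [set: K] ->
  (forall X : Type, [set: C] #<= [set: X -> bool] -> [set: D] #<= [set: X]) ->
  (forall m, injective (code m)) ->
  (forall m g x, Phi x (code m g) = g (sigL [set y | R y m] x)) ->
  string_small D K F -> Phi @^-1` F #<= [set: K].
Proof.
move=> infK slK woK Cmin CK Dmin codeinj PhiE [S [[Fdim _] [_ nDS]]].
have nCS : ~ ([set: C] #<= [set: S -> bool]) by move=> /Dmin.
(* By comparability this bounds the preimage by [2^S]; comparability and [nCS] then give
   [2^S <= |C| <= |K|]. *)
suff nSF : ~ ([set: S -> bool] #<= Phi @^-1` F).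
  rewrite -(card_le_eql (card_setT _)).
  have [FS|] := card_le_total (Phi @^-1` F) (S -> bool); last first.
    by rewrite (card_le_eqr (card_setT _)) => /nSF.
  have [//|SC] := card_le_total C (S -> bool).
  exact: card_le_trans FS (card_le_trans SC CK).
move=> /card_le_set_injP[x xinj xF].
have [m minj] := restriction_injective woK Cmin nCS infK xinj.
pose r b := sigL [set y | R y m] (x b).
pose g s t := `[< exists2 b, r b = t & b s >].
have gE s b : g s (r b) = b s.
  by apply/asboolP/idP => [[b' /minj ->]|bs] //; exists b.
pose h s := code m (g s).
have hinj : injective h.
  (* Evaluating [g s = g s'] at [r b], with [b] the indicator of [s'], forces [s = s']. *)
  move=> s s' /codeinj e; have := gE s' (fun t => `[< t = s' >]).
  by rewrite -e gE => ss'; apply: (asbool_eq_equiv ss').2.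
apply: (Fdim (range h)); first by apply: inj_card_eq => ? ? _ _ /hinj.
apply/seteqP; split=> // u _.
have hr s : range h (h s) by exists s.
(* [b] copies the prescribed pattern [u] along [h], so that [Phi (x b)] realises [u] on the range of
   [h]. *)
pose b s := u (SigSub (mem_set (hr s))).
exists (Phi (x b)); first exact: xF.
apply/funext => -[k kh] /=; have /set_mem[s _ sk] := kh; subst k.
by rewrite PhiE -/(r b) gE /b; congr (u _); apply: val_inj.
Qed.

(* Koenig's argument: split the coordinates of 2^K into K-many blocks of size K
   and diagonalise against the (n, k)-th elements of all pieces in block (n, k). *)
Lemma konig_cover (K Y : Type) (h : Y -> nat -> K -> K -> bool) :
  infinite_set [set: K] -> [set: K * K] #<= [set: K] ->
  (forall x, exists y n k, h y n k = x) -> [set: K -> bool] #<= [set: Y].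
Proof.
move=> /infiniteP /card_le_injP[i iinj] /card_le_injP[c cinj] hsurj.
pose code (n : nat) (k l : K) := c (c (i n, k), l).
apply: contrapT => nKY.
(* As [y] varies, at most [|Y|] functions appear on block [nk]; since [2^K] does not embed in [Y],
   some [z] is missed. *)
have /choice[z zP] (nk : nat * K) : exists z : K -> bool,
    forall y, z <> h y nk.1 nk.2 \o code nk.1 nk.2.
  apply: contrapT => /forallNP nz; apply: nKY.
  apply: (@surj_card_le _ _ (fun y => h y nk.1 nk.2 \o code nk.1 nk.2)) => z.
  by have /existsNP[y /contrapT ->] := nz z; exists y.
(* The blocks are disjoint because [c] and [i] are injective, so all the missed functions fit into
   one point [x]. *)
pose x t := `[< exists n k l, code n k l = t /\ z (n, k) l >].
have xE n k l : x (code n k l) = z (n, k) l.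
  apply/asboolP/idP => [[n' [k' [l' [/cinj [/cinj [/iinj -> ->] ->]]]]]//|].
  by exists n, k, l.
have [y [n [k e]]] := hsurj x.
by apply: (zP (n, k) y); apply/funext => l; rewrite /= e xE.
Qed.

(** * Singletons and the value of the covering number *)

(** The string dimension is 1: a single function cannot realise both constant patterns on a nonempty
    set, but it does shatter the empty set, which excludes dimension 0. *)
Lemma string_small_singleton (D K : Type) (f : K -> bool) :
  card_lt [set: unit] [set: D] -> string_small D K [set f].
Proof.
move=> unitD; exists unit; split=> //; split=> [A|Y nY].
  rewrite card_eq_le => /andP[_ /card_le_set_injP[a _ /(_ tt) Aa]] Ash.
  have const (u : A -> bool) : u = sigL A f.
    have : restrict_family [set f] A u by rewrite Ash.
    by move=> [g -> <-].
  by have := congr1 (@^~ (SigSub (mem_set Aa)))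
    (etrans (const (fun=> true)) (esym (const (fun=> false)))).
have [[y _]|nexY] := pselect (exists y : Y, True).
  by apply/card_le_injP; exists (fun=> y) => -[] [].
have Y0 : [set: Y] = set0.
  by apply/seteqP; split=> // y _; apply: nexY; exists y.
exfalso; apply: (nY set0); first by rewrite Y0 card_eq00.
apply/seteqP; split=> // u _; exists f => //.
by apply/funext => -[k k0]; have := set_mem k0.
Qed.

(** If [D] had at most one element, [C] would have at most two; a cofinal set of at most two points
    would make [K] a single initial segment, against [segment_small]. *)
Lemma unit_lt_least_pow (K C D : Type) (R : rel K) :
  infinite_set [set: K] -> strong_limit K -> initial_well_order R ->
  (exists A : set K, cofinal R A /\ A #= [set: C]) ->
  [set: C] #<= [set: D -> bool] -> card_lt [set: unit] [set: D].
Proof.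
move=> infK slK woK [A [Acof AC]] CD.
have woR := woK.1.
have nDu : ~ ([set: D] #<= [set: unit]).
  move=> /card_le_pow Du.
  have : A #<= [set: bool].
    rewrite (card_le_eql AC); apply: card_le_trans (card_le_trans CD Du) _.
    by apply/card_le_injP; exists (@^~ tt) => u v e; apply/funext => -[].
  move=> /card_le_setT_injP[f finj].
  have [k0 _] := infinite_setN0 infK.
  (* [h b] is the point of [A] labelled [b], or [k0] if no point carries that label. *)
  have /choice[h hP] b : exists k, forall a, f a = b -> val a = k.
    have [[a fa]|na] := pselect (exists a, f a = b).
      by exists (val a) => a' fa'; congr val; apply: finj; rewrite fa fa'.
    by exists k0 => a fa; case: na; exists a.
  have [m [mt mf]] : exists m, R (h true) m /\ R (h false) m.
    by have [?|?] := well_order_total woR (h true) (h false);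
      [exists (h false)|exists (h true)]; split=> //; apply: well_order_refl.
  have [_] := segment_small slK woK m; apply.
  rewrite (card_le_eqr (card_setT _)); apply: subset_card_le => k _.
  have [a Aa ka] := Acof k; apply: (well_order_trans woR ka).
  rewrite -[a]/(val (SigSub (mem_set Aa) : A)) (hP _ _ erefl).
  by case: (f _).
by split=> //; have [//|] := card_le_total unit D.
Qed.

Lemma sd_least_pow_cofinality (K C D : Type) :
  infinite_set [set: K] -> strong_limit K -> is_cofinality K C ->
  is_least_card (fun X : Type => [set: C] #<= [set: X -> bool]) D ->
  is_sd D K (K -> bool).
Proof.
move=> infK slK [R [woK [cofC leastC]]] [CD Dmin].
have Cmin (A : set K) : cofinal R A -> [set: C] #<= A.
  move=> Acof; rewrite -(card_le_eqr (card_setT A)); apply: leastC.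
  by exists A; split=> //; rewrite card_eq_sym card_setT.
have CK : [set: C] #<= [set: K].
  by apply: Cmin => x; exists x => //; apply: (well_order_refl woK.1).
have unitD := unit_lt_least_pow infK slK woK cofC CD.
split=> [|Y [A [Aideal Acover AY]]].
  (* Upper bound: the singletons cover, and there are [2^K] of them. *)
  exists (range set1); split.
  - move=> _ [f _ <-]; exists [set [set f]]; split; first exact: countable1.
      by move=> _ ->; apply: string_small_singleton.
    by move=> g gf; exists [set f].
  - by apply/seteqP; split=> // f _; exists [set f] => //; exists f.
  - by apply: inj_card_eq => f g _ _ fg; have : [set f] g by rewrite fg.
have [Phi [code [codeinj PhiE]]] := independent_coding slK woK.
have small F : string_small D K F -> Phi @^-1` F #<= [set: K].
  exact: preimage_string_small infK slK woK Cmin CK Dmin codeinj PhiE.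
have enum (B : A) : exists h : nat -> K -> K -> bool,
    forall x, val B (Phi x) -> exists n k, h n k = x.
  have [G [Gcount Gsmall BG]] := Aideal _ (set_valP B).
  have /card_le_setT_injP[i iinj] := Gcount.
  have /choice[h hP] (n : nat) : exists h : K -> K -> bool,
      forall (F : G) x, i F = n -> val F (Phi x) -> exists k, h k = x.
    have [[F iF]|nF] := pselect (exists F, i F = n); last first.
      by exists (fun=> xpredT) => F x iF; case: nF; exists F.
    have /small/card_le_setT_injP[j jinj] := Gsmall _ (set_valP F).
    have /choice[h hP] k : exists x, forall z, j z = k -> val z = x.
      have [[z jz]|nz] := pselect (exists z, j z = k).
        by exists (val z) => z' jz'; congr val; apply: jinj; rewrite jz jz'.
      by exists (fun=> true) => z jz; case: nz; exists z.
    exists h => F' x iF'; have -> : F' = F by apply: iinj; rewrite iF iF'.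
    move=> Fx.
    pose z : Phi @^-1` val F := SigSub (mem_set (Fx : (Phi @^-1` val F) x)).
    by exists (j z); rewrite -(hP _ z).
  exists h => x /BG[F GF Fx].
  pose F' : G := SigSub (mem_set GF); have [k hk] := hP (i F') F' x erefl Fx.
  by exists (i F'), k.
have [h hP] := choice enum.
rewrite -(card_le_eqr AY) -(card_le_eqr (card_setT A)).
apply: (@konig_cover _ _ h) => //; first exact: card_square_le slK woK.
move=> x; have [B AB Bx] : (\bigcup_(B in A) B) (Phi x) by rewrite Acover.
have [n [k hk]] := hP (SigSub (mem_set AB)) _ Bx.
by exists (SigSub (mem_set AB)), n, k.
Qed.

(** * The case of the natural numbers *)

Lemma card_lt_natP (T : Type) (A : set T) : card_lt A [set: nat] <-> finite_set A.
Proof.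
rewrite finite_setPn; split=> [[]//|fA]; split=> //.
by apply: finite_set_countable; apply/finite_setPn.
Qed.

Lemma finite_pow (T : Type) : finite_set [set: T] -> finite_set [set: T -> bool].
Proof.
move=> /finite_set_leP[n]; rewrite (card_le_eqr card_II) => /card_le_pow Tn.
apply: card_le_finite Tn _.
apply: (@card_le_finite _ _ _ [set: {ffun 'I_n -> bool}]); last exact: finite_finset.
apply/card_le_injP; exists (fun b => [ffun i => b i]) => b b' bb'.
apply/funext => i.
by move/ffunP: bb' => /(_ i); rewrite !ffunE.
Qed.

Lemma strong_limit_nat : strong_limit nat.
Proof. by move=> L; rewrite !card_lt_natP; apply: finite_pow. Qed.

Lemma initial_well_order_leq : initial_well_order leq.
Proof.
split=> [|n].
  apply: antisymmetric_well_order => [m n /anti_leq //|P [n Pn]].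
  have exP : exists n, n \in P by exists n.
  by case: (ex_minnP exP) => m Pm mmin; exists m; split=> // k /mmin.
apply/card_lt_natP; apply: sub_finite_set (finite_II n.+1) => m [].
by [].
Qed.

Lemma is_cofinality_nat : is_cofinality nat nat.
Proof.
exists leq; split; first exact: initial_well_order_leq.
split=> [|X [A [Acof AX]]].
  by exists setT; split=> // n; exists n.
rewrite -(card_le_eqr AX); apply/infiniteP => finA.
(* A finite cofinal [A] would make [nat] a finite union of finite segments; the successor puts [k]
   itself into its segment. *)
apply: infinite_nat; apply: (@sub_finite_set _ _ (\bigcup_(k in A) `I_k.+1)).
  by move=> n _; have [k Ak nk] := Acof n; exists k.
by apply: bigcup_finite => // k _; apply: finite_II.
Qed.

Lemma is_least_pow_nat :
  is_least_card (fun X : Type => [set: nat] #<= [set: X -> bool]) nat.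
Proof.
split=> [|Y]; first exact: card_le_pow_self.
by move=> /infiniteP natY; apply/infiniteP => /finite_pow.
Qed.

Theorem theorem1p2 :
  (forall K C D : Type,
     infinite_set [set: K] -> strong_limit K ->
     is_cofinality K C ->
     is_least_card (fun X : Type => [set: C] #<= [set: X -> bool]) D ->
     is_sd D K (K -> bool)) /\
  is_sd nat nat (nat -> bool).
Proof.
split; first exact: sd_least_pow_cofinality.
exact: sd_least_pow_cofinality infinite_nat strong_limit_nat is_cofinality_nat
  is_least_pow_nat.
Qed.
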